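(* Let $D$ be a connected diagram of a link $K\subset S^3$ with a marked point $p$ on one of its edges and a checkerboard colouring, and let $T$ be a spanning tree of the black graph of $D$. Then the generators of the Heegaard Floer chain complex $\widehat{CF}(\mathcal H_2(D,T))$ are in one-to-one correspondence with the Kauffman states of $D$.
   Context: Diagrams and graphs. $D$ is regarded as a 4-valent plane graph whose vertices are the crossings; its regions are the components of its complement. The point $p$ lies in the interior of an edge; the black region and the white region adjacent to $p$ are the marked regions. The black graph $B$ has one vertex for each black region and one edge for each crossing, joining the two black regions incident to it (drawn through the crossing); the white graph $W$ is defined likewise. A spanning tree $T$ of $B$ has a dual spanning tree $T^*$ of $W$, consisting of the edges of $W$ at those crossings whose $B$-edge is not in $T$. Through each crossing $c$ passes exactly one edge $e_c$ of $T\cup T^*$. A Kauffman state $x$ of the marked diagram $D$ assigns to each crossing $c$ one of the four corners $x(c)$ of regions at $c$, so that each unmarked region contains exactly one chosen corner and the marked regions contain none. The Heegaard diagram $\mathcal H_2(D,T)=(\Sigma,\alpha,\beta)$. $\Sigma$ is the boundary of a closed regular neighbourhood $U$ of $D$ in $S^3$; the plane of the diagram divides $\Sigma$ into a top half and a bottom half. The $\alpha$ curves are the intersections of $\Sigma$ with all regions of $D$ except the marked white region; write $\alpha_R$ for the curve of the region $R$ and $\delta_1$ for the intersection of $\Sigma$ with the marked white region (not an $\alpha$ curve). The $\beta$ curves are: a meridian $\beta_p$ of the marked edge near $p$; and one curve $\beta_c$ for each crossing $c$. On the top half, $\beta_c$ consists of two arcs, one crossing each of the two understrand edge-ends at $c$;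 each joins the curves ($\alpha_R$ or $\delta_1$) of the two regions on the two sides of that edge-end, near their corners at $c$. On the bottom half, $\beta_c$ consists of two arcs. The first is the projection to the bottom half of the part of $e_c$ lying in $U$; it joins two opposite corners at $c$. Cutting the bottom half along these first arcs for all crossings gives an annulus, and cutting further along the bottom arc of $\beta_p$ gives a disk; the second bottom arc of $\beta_c$ is an arc in this disk joining the remaining two endpoints, these second arcs being chosen disjoint from one another (unique up to isotopy). Generators of $\widehat{CF}(\Sigma,\alpha,\beta)$ are the points of $\mathbb T_\alpha\cap\mathbb T_\beta\subset \mathrm{Sym}^g(\Sigma)$, i.e. tuples of intersection points between $\alpha$ and $\beta$ curves with exactly one point on each $\alpha$ curve and on each $\beta$ curve. *)

(* Defs.v *)
From mathcomp Require Import all_boot all_fingroup all_algebra.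

Set Implicit Arguments.
Unset Strict Implicit.
Unset Printing Implicit Defensive.

Record mgraph := MGraph {
  mvert : finType;
  medge : finType;
  mend : medge -> bool -> mvert
}.

Section SpanningTree.
Variable G : mgraph.
Implicit Types (T : {set medge G}) (a : medge G * bool).

Definition msrc a : mvert G := mend a.1 a.2.
Definition mtgt a : mvert G := mend a.1 (~~ a.2).

Definition madj T : rel (mvert G) :=
  fun u v => [exists a, [&& a.1 \in T, msrc a == u & mtgt a == v]].

Definition is_mcycle (s : seq (medge G * bool)) : bool :=
  [&& s != [::], path.cycle (fun a a' => mtgt a == msrc a') s,
      uniq [seq a.1 | a <- s] & uniq [seq msrc a | a <- s]].

Definition spanning_tree T : Prop :=
  (forall u v, connect (madj T) u v) /\
  (forall s, all (fun a => a.1 \in T) s -> ~~ is_mcycle s).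

End SpanningTree.

(* Edge-ends. [inl (c, i)] is the i-th edge-end at the crossing [c], in
   counterclockwise order; those with [i = 0, 2] belong to the understrand and
   those with [i = 1, 3] to the overstrand. The marked point is treated as an
   extra 2-valent vertex with edge-ends [inr true] and [inr false]; this also
   covers the crossingless diagram of the unknot. *)
Definition dart (C : finType) : finType := (C * 'I_4 + bool)%type.

Definition rot_dart C (d : dart C) : dart C :=
  match d with inl (c, i) => inl (c, (i + 1)%R) | inr b => inr (~~ b) end.

Lemma rot_dart_inj C : injective (@rot_dart C).
Proof.
move=> [[c i]|b] [[c' i']|b'] //; last by case=> /negb_inj ->.
move=> H; have {}H : (c, (i + 1)%R) = (c', (i' + 1)%R) := inl_inj H.
have /= -> := congr1 fst H.
by have /= /(@GRing.addIr _ 1%R) -> := congr1 snd H.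
Qed.

Definition node C : {perm dart C} := perm (@rot_dart_inj C).

(* A connected 4-valent graph on the sphere, as a combinatorial map. The
   permutation [face_perm] follows a region lying to the left of [d]: an
   edge-end [d] also names the corner between [d] and [node d], and
   [face_perm d] is the next corner of the same region. *)
Definition face_perm C (edge : {perm dart C}) : {perm dart C} :=
  (edge * (node C)^-1)%g.

Record marked_diagram := MarkedDiagram {
  crossing : finType;
  edge : {perm dart crossing};
  edgeK : involutive edge;
  edge_free : forall d, edge d != d;
  diagram_connected : forall d d',
    connect (fun x y => (y == node crossing x) || (y == edge x)) d d';
  diagram_planar :
    #|porbits (node crossing)| + #|porbits (face_perm edge)|
    = (#|porbits edge| + 2)%N
}.

Arguments edge {_}.

Section Diagram.
Variable D : marked_diagram.
Local Notation C := (crossing D).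
Local Notation face := (face_perm (@edge D)).

(* A region is given by the set of its corners. *)
Definition region : finType := {R : {set dart C} | R \in porbits face}.

Lemma porbit_face (d : dart C) : porbit face d \in porbits face.
Proof. exact: imset_f. Qed.

Definition region_of (d : dart C) : region :=
  exist (fun R : {set dart C} => R \in porbits face) _ (porbit_face d).

Definition corner_region (c : C) (i : 'I_4) : region := region_of (inl (c, i)).

Definition marked (R : region) : bool := [exists b, R == region_of (inr b)].

(* The two regions on the sides of the edge of [d] are [region_of d] and
   [region_of (edge d)]. *)
Record coloring := Coloring {
  black : pred region;
  black_edge : forall d, black (region_of (edge d)) = ~~ black (region_of d)
}.

Definition is_kauffman_state (x : {ffun C -> 'I_4}) : bool :=
  [forall R : region,
     #|[set c | corner_region c (x c) == R]| == (if marked R then 0 else 1)].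

Definition kauffman_state : finType :=
  {x : {ffun C -> 'I_4} | is_kauffman_state x}.

Variable K : coloring.

Lemma region_face d : region_of (face d) = region_of d.
Proof. by apply/val_inj; exact: (porbit_perm face 1 d). Qed.

Lemma black_node d : black K (region_of (node C d)) = ~~ black K (region_of d).
Proof.
rewrite -[in RHS](_ : face (edge (node C d)) = d).
  by rewrite region_face black_edge negbK.
by rewrite permM edgeK permK.
Qed.

(* The two corners at [c] of colour [col] ([true] for black), through which
   the edge at [c] of the graph of that colour leaves the crossing. *)
Definition end_corner (col : bool) (c : C) (b : bool) : 'I_4 :=
  ((if black K (corner_region c 0) == col then 0 else 1)
   + (if b then 2%:R else 0))%R.

Lemma end_cornerP col c b :
  black K (corner_region c (end_corner col c b)) == col.
Proof.
have S i : black K (corner_region c (i + 1)%R) = ~~ black K (corner_region c i).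
  by rewrite -black_node permE.
have S1 : black K (corner_region c 1%R) = ~~ black K (corner_region c 0%R).
  by rewrite -S GRing.add0r.
rewrite /end_corner; case: (boolP (black K (corner_region c 0%R) == col)) => H; case: b;
  rewrite ?GRing.mulr2n ?GRing.addrA ?GRing.addr0 ?S ?negbK ?S1 ?GRing.add0r
          ?S1 ?negbK //; by case: (black K _) col H => [] [].
Qed.

Definition region_graph (col : bool) : mgraph :=
  @MGraph {R : region | black K R == col} C
    (fun c b => exist (fun R : region => black K R == col) _
                      (end_cornerP col c b)).

Definition black_graph := region_graph true.
Definition white_graph := region_graph false.

(* The plane of the diagram cuts the surface Sigma into a top and a bottom
   half, which are two copies of a planar ribbon neighbourhood of [D], glued
   along one curve for each region [R], the intersection of Sigma with [R].
   A corner [d] is also the name of a point of this curve near that corner, so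
   that the points of the curve of [R] are the elements of [val R].

   An arc properly embedded in one of the halves is recorded, up to isotopy
   fixing its ends, by its ends and by the walk in [D] that it follows (each
   edge being named by the edge-end through which it is entered). The walk is
   empty for an arc which stays near a single vertex. *)
Record arc := Arc {
  arc_top : bool;
  arc_src : dart C;
  arc_walk : seq (dart C);
  arc_tgt : dart C
}.

Definition closed_curve (s : seq arc) : bool :=
  path.cycle (fun a a' => (arc_tgt a == arc_src a') && (arc_top a != arc_top a')) s.

(* The interiors of the arcs avoid the plane of the diagram, so a curve made of
   arcs meets the curves of the regions in the ends of its arcs only. *)
Definition curve_points (s : seq arc) : {set dart C} :=
  [set d in [seq arc_src a | a <- s]].

(* Every alpha curve is the curve of a region; [alpha] is the set of these
   regions. *)
Record heegaard_diagram := HeegaardDiagram {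
  alpha : {set region};
  beta_index : finType;
  beta : beta_index -> seq arc;
  beta_closed : forall j, closed_curve (beta j)
}.

(* As the alpha curves are disjoint, a point of T_alpha cap T_beta in
   Sym^g(Sigma) is a set of points of Sigma. *)
Definition is_generator (H : heegaard_diagram) (x : {set dart C}) : bool :=
  [&& x \subset (\bigcup_(R in alpha H) val R)
             :&: \bigcup_j curve_points (beta (h := H) j),
      [forall R in alpha H, #|x :&: val R| == 1]
    & [forall j, #|x :&: curve_points (beta (h := H) j)| == 1]].

Definition generator (H : heegaard_diagram) : finType :=
  {x : {set dart C} | is_generator H x}.

Variable T : {set medge black_graph}.

Definition dual_tree : {set medge white_graph} := ~: T.

(* [i] is one of the two corners joined by [e_c], the edge of [T] or of
   [dual_tree] at [c]. *)
Definition tree_corner (c : C) (i : 'I_4) : bool :=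
  [exists b, (c \in T) && (i == end_corner true c b)
             || (c \in dual_tree) && (i == end_corner false c b)].

(* Cutting the bottom half along the [e_c] leaves two pieces at each crossing,
   each containing two consecutive edge-ends: [i] is paired with [i + 1] unless
   [e_c] separates them at the corner [i], and [turn] exchanges the two. The
   resulting annulus runs along the edges of [D], and [onward] is the passage
   from one edge to the next along its core. *)
Definition turn (d : dart C) : dart C :=
  match d with
  | inl (c, i) => inl (c, if tree_corner c i then (i - 1)%R else (i + 1)%R)
  | inr b => inr (~~ b)
  end.

Definition onward (d : dart C) : dart C := turn (edge d).

Definition at_crossing (c : C) (d : dart C) : bool :=
  if d is inl (c', _) then c' == c else false.

Definition at_mark (d : dart C) : bool := if d is inr _ then true else false.

(* The walk along the core of the annulus from [d], until it arrives at [c]. *)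
Definition walk_to (c : C) (d : dart C) : seq (dart C) :=
  let s := fingraph.orbit onward d in
  take (find (fun d' => at_crossing c (edge d')) s).+1 s.

(* The second arc of [beta_c] issued from the corner [i], which is not an end of
   [e_c], follows the core of the annulus from the piece at [c] containing this
   corner to the other piece, in the direction that does not meet [beta_p].
   Such arcs lie in a disk, where they are determined by their ends. *)
Definition second_walk (c : C) (i : 'I_4) : seq (dart C) :=
  let w := walk_to c (inl (c, i)) in
  if has (fun d => at_mark (edge d)) w then walk_to c (inl (c, (i + 1)%R))
  else w.

Definition bottom_arc (c : C) (i : 'I_4) : arc :=
  Arc false (inl (c, i)) (if tree_corner c i then [::] else second_walk c i)
      (inl (c, (i + 2%:R)%R)).

(* The edge-end [i] at [c] has the corner [i] on its left and [i - 1] on its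
   right; the understrand edge-ends are 0 and 2. *)
Definition H2_beta (j : option C) : seq arc :=
  match j with
  | Some c =>
      [:: Arc true (inl (c, 0%R)) [::] (inl (c, (0 - 1)%R));
          bottom_arc c (0 - 1)%R;
          Arc true (inl (c, (2%:R - 1)%R)) [::] (inl (c, 2%:R%R));
          bottom_arc c 2%:R%R]
  | None =>
      [:: Arc true (inr true) [::] (inr false);
          Arc false (inr false) [::] (inr true)]
  end.

Lemma H2_beta_closed j : closed_curve (H2_beta j).
Proof.
case: j => [c|] //.
have E1 : (0 - 1 + 2%:R)%R = (2%:R - 1)%R :> 'I_4 by exact: val_inj.
have E2 : (2%:R + 2%:R)%R = 0%R :> 'I_4 by exact: val_inj.
by rewrite /closed_curve /= !E1 !E2 !eqxx.
Qed.

Definition H2 : heegaard_diagram :=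
  {| alpha := [set R | ~~ (marked R && ~~ black K R)];
     beta_index := option C;
     beta := H2_beta;
     beta_closed := H2_beta_closed |}.

End Diagram.

(* Main.v *)
Require Import Defs.
From mathcomp Require Import all_boot all_fingroup all_algebra.

(** The curve [beta_c] meets the curves of the regions in the four corners at
    [c], and [beta_p] meets them in one point on each of the two marked regions.
    The marked white region carries no alpha curve, so a generator must use the
    point of [beta_p] on the marked black region; the other points of the
    generator then choose one corner at each crossing, one in each unmarked
    region and none in the marked ones. *)

Set Implicit Arguments.
Unset Strict Implicit.
Unset Printing Implicit Defensive.

Section KauffmanStates.
Variables (D : marked_diagram) (K : coloring D).
Variable T : {set medge (black_graph K)}.
Local Notation C := (crossing D).
Implicit Types (d : dart C) (R : region D) (c : C) (s : {ffun C -> 'I_4}).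
Implicit Types (x : {set dart C}).

Lemma mem_region d R : (d \in val R) = (region_of d == R).
Proof.
case: R => R HR; rewrite -val_eqE /=.
by case/imsetP: HR => e _ ->; rewrite eq_porbit_mem porbit_sym.
Qed.

(** The four arcs of [beta_c] start at the corners 0, 3, 1 and 2 in turn; the tree enters only in
    the walks of the bottom arcs. *)
Lemma curve_points_crossing c :
  curve_points (H2_beta T (Some c)) = [set d | at_crossing c d].
Proof.
apply/setP => -[[c' i]|b]; rewrite !inE /= ?inE //=.
have E (k j : 'I_4) : (inl (c', k) == inl (c, j) :> dart C) = (c' == c) && (k == j).
  by [].
rewrite !E -!andb_orr; case: (c' == c) => //= {E}.
by case: i => [[|[|[|[|n]]]]].
Qed.

Lemma curve_points_mark : curve_points (H2_beta T None) = [set d | at_mark d].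
Proof. by apply/setP => -[[c' i]|[]]; rewrite !inE. Qed.

Lemma mem_alpha_curves d :
  (d \in \bigcup_(R in alpha (H2 T)) val R) = (region_of d \in alpha (H2 T)).
Proof.
apply/bigcupP/idP => [[R HR]|H]; first by rewrite mem_region => /eqP ->.
by exists (region_of d) => //; rewrite mem_region.
Qed.

(** Reduces the first clause of [is_generator] to lying on the alpha curves. *)
Lemma mem_beta_curves d :
  d \in \bigcup_(j : beta_index (H2 T)) curve_points (beta j).
Proof.
case: d => [[c i]|b]; apply/bigcupP.
  by exists (Some c) => //=; rewrite curve_points_crossing inE /=.
by exists None => //=; rewrite curve_points_mark inE.
Qed.

(** Chosen so that [inr black_mark] is the corner at the marked point on its black side. *)
Definition black_mark : bool := black K (region_of (inr true)).

(** Turning about the 2-valent vertex exchanges its two corners and, by [black_node], their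
    colours. *)
Lemma black_markE b : black K (region_of (inr b)) = (b == black_mark).
Proof.
have := black_node K (inr true); rewrite permE /= /black_mark.
by case: b => [|->]; case: (black _ _).
Qed.

Lemma marked_mark b : marked (region_of (inr b) : region D).
Proof. by apply/existsP; exists b. Qed.

Lemma region_of_black_mark R :
  (region_of (inr black_mark) == R) = marked R && black K R.
Proof.
apply/eqP/andP => [<-|[/existsP[b /eqP ->]]].
  by rewrite marked_mark black_markE eqxx.
by rewrite black_markE => /eqP ->.
Qed.

Definition state_points s : {set dart C} :=
  [set d | match d with inl (c, i) => i == s c | inr b => b == black_mark end].

(** The default [ord0] is never taken on a generator, which has a point on each [beta_c]. *)
Definition point_corners x : {ffun C -> 'I_4} :=
  [ffun c => odflt ord0 [pick i | inl (c, i) \in x]].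

Lemma state_pointsK : cancel state_points point_corners.
Proof.
move=> s; apply/ffunP => c; rewrite ffunE; case: pickP => [i|/(_ (s c))] /=.
  by rewrite inE => /eqP.
by rewrite inE eqxx.
Qed.

Lemma card_state_points_region s R :
  #|state_points s :&: val R|
  = ((marked R && black K R) + #|[set c | corner_region c (s c) == R]|)%N.
Proof.
(* Split off the point on [beta_p]; the remaining points are the chosen corners, one for each
   crossing. *)
rewrite (cardsD1 (inr black_mark)) !inE eqxx mem_region region_of_black_mark.
congr addn.
rewrite -[RHS](card_imset (f := fun c => inl (c, s c) : dart C)); last first.
  by move=> c c' [].
apply: eq_card => d; apply/idP/imsetP => [|[c]]; last first.
  by rewrite inE => Hc ->; rewrite !inE /= eqxx mem_region.
rewrite !inE.
case: d => [[c i]|b] /=; last first.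
  by case: (b =P black_mark) => [->|]; rewrite ?eqxx ?andbF.
by case/andP => /eqP ->; rewrite mem_region => Hc; exists c; rewrite ?inE.
Qed.

(** On a marked black region the point of [beta_p] already gives the count 1, so no corner is chosen
    there; on an unmarked region only chosen corners count. *)
Lemma generator_state_points s :
  is_generator (H2 T) (state_points s) = is_kauffman_state s.
Proof.
apply/and3P/forallP => [[/subsetP Hsub /forall_inP HR _] R|Hs].
  case: (boolP (R \in alpha (H2 T))) => [Ra|].
    have := HR _ Ra; rewrite card_state_points_region; move: Ra; rewrite inE.
    by case: (marked R); case: (black K R).
  (* [R] is marked and white: a corner chosen in it would be a point of the generator on no alpha
     curve. *)
  rewrite inE negbK => Rw; have /andP[-> _] := Rw.
  rewrite cards_eq0 -subset0; apply/subsetP => c; rewrite inE => /eqP Hc.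
  have /Hsub : inl (c, s c) \in state_points s by rewrite inE.
  by rewrite inE mem_alpha_curves inE -/(corner_region _ _) Hc Rw.
split.
- apply/subsetP => d; rewrite !inE mem_alpha_curves mem_beta_curves andbT inE.
  case: d => [[c i] /eqP ->|b /eqP ->]; last by rewrite black_markE eqxx andbF.
  (* If this region were marked, the state would choose no corner in it, yet it chooses [s c]. *)
  apply/negP => /andP[Rm _]; have := Hs (corner_region c (s c)).
  by rewrite Rm cards_eq0 => /eqP/setP/(_ c); rewrite !inE eqxx.
- apply/forall_inP => R; rewrite inE card_state_points_region => Ra.
  by have /eqP -> := Hs R; move: Ra; case: (marked R); case: (black K R).
- apply/forallP => -[c|]; apply/cards1P.
    exists (inl (c, s c)); rewrite /= curve_points_crossing.
    apply/setP => -[[c' i]|b]; rewrite !inE //= ?andbF //.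
    rewrite -[RHS]/((c' == c) && (i == s c)).
    by case: (c' =P c) => [->|_]; rewrite ?andbT ?andbF.
  exists (inr black_mark); rewrite /= curve_points_mark.
  by apply/setP => -[[c i]|b]; rewrite !inE ?andbF ?andbT.
Qed.

Lemma point_cornersK x :
  is_generator (H2 T) x -> state_points (point_corners x) = x.
Proof.
case/and3P => /subsetP Hsub _ /forallP Hb; apply/setP => -[[c i]|b].
  rewrite inE ffunE; have /= := Hb (Some c); rewrite curve_points_crossing.
  case/cards1P => d /setP Hd.
  (* [d] is the only point of [x] on [beta_c], so [pick] can only return its corner. *)
  have H j : (inl (c, j) \in x) = (inl (c, j) == d).
    by rewrite -[RHS]in_set1 -Hd !inE /= eqxx andbT.
  have := set11 d; rewrite -Hd !inE => /andP[dx].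
  case: d dx H {Hd} => [[c' k]|] //= dx H /eqP Ec; subst c'.
  case: pickP => [j|/(_ k)]; last by rewrite dx.
  by rewrite !H => /eqP Ejk; rewrite -Ejk -[RHS]/((c == c) && (i == j)) eqxx.
(* The white corner at the marked point lies on no alpha curve. *)
have black_only b' : inr b' \in x -> b' == black_mark.
  move=> /Hsub; rewrite inE mem_alpha_curves inE marked_mark black_markE negbK.
  by case/andP.
rewrite inE; apply/eqP/idP => [->|/black_only/eqP //].
have /= := Hb None; rewrite curve_points_mark => /cards1P[d /setP/(_ d)].
rewrite !inE eqxx => /andP[]; case: d => [//|b'] Hx _.
by rewrite -(eqP (black_only _ Hx)).
Qed.

Lemma kauffman_point_corners x :
  is_generator (H2 T) x -> is_kauffman_state (point_corners x).
Proof. by move=> Hx; rewrite -generator_state_points point_cornersK. Qed.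

Definition kauffman_of_generator (x : generator (H2 T)) : kauffman_state D :=
  exist (fun s => is_kauffman_state s) _ (kauffman_point_corners (valP x)).

Lemma kauffman_of_generator_bij : bijective kauffman_of_generator.
Proof.
have gen (s : kauffman_state D) : is_generator (H2 T) (state_points (val s)).
  by rewrite generator_state_points (valP s).
exists (fun s : kauffman_state D =>
          exist (fun x => is_generator (H2 T) x) _ (gen s)) => [x|s];
  apply: val_inj => /=.
  exact/point_cornersK/(valP x).
exact: state_pointsK.
Qed.

End KauffmanStates.

Theorem proposition3p5 (D : marked_diagram) (K : coloring D)
    (T : {set medge (black_graph K)}) (hT : spanning_tree T) :
  exists f : generator (H2 T) -> kauffman_state D, bijective f.
Proof.
exists (@kauffman_of_generator D K T).
exact: kauffman_of_generator_bij.
Qed.
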